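(* Let $(M,g)$ be a Lorentzian surface with a Spin structure and spinor bundle $S=S^+\oplus S^-$. (i) A section $\varphi\in\Gamma(S^+)$ is harmonic if and only if $\nabla^S_X\varphi\equiv 0$ for all (local) $\mathcal{X}$-vector fields $X$; a section $\varphi\in\Gamma(S^-)$ is harmonic if and only if $\nabla^S_Y\varphi\equiv0$ for all (local) $\mathcal{Y}$-vector fields $Y$. (ii) A section $\varphi\in\Gamma(S^+)$ is a twistor spinor if and only if $\nabla^S_Y\varphi\equiv 0$ for all (local) $\mathcal{Y}$-vector fields $Y$; a section $\varphi\in\Gamma(S^-)$ is a twistor spinor if and only if $\nabla^S_X\varphi\equiv0$ for all (local) $\mathcal{X}$-vector fields $X$.
   Context: A Lorentzian surface $(M,g)$ is a smooth oriented $2$-manifold with a metric of signature $(1,1)$; in an orthonormal basis $(s_1,s_2)$ the vector $s_1$ is timelike ($g(s_1,s_1)=-1$) and $s_2$ is spacelike ($g(s_2,s_2)=1$). The light cone consists of two one-dimensional lightlike distributions $\mathcal{X},\mathcal{Y}$: a lightlike vector $v$ lies in $\mathcal{X}$ iff there is a lightlike $w$ such that $(v,w)$ is an oriented basis and $v+w$ is spacelike; the other distribution is $\mathcal{Y}$. For an oriented orthonormal frame $s=(s_1,s_2)$, $X_s=s_1+s_2$ lies in $\mathcal{X}$ and $Y_s=-s_1+s_2$ lies in $\mathcal{Y}$. $\mathcal{X}$- (resp. $\mathcal{Y}$-) vector fields are lightlike vector fields that are sections of $\mathcal{X}$ (resp. $\mathcal{Y}$). The spinor bundle $S=Q\times_{Spin}\Delta_{1,1}$,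 $\Delta_{1,1}=\mathbb{C}^2$, uses the Clifford representation $e_1\mapsto\begin{pmatrix}0&i\\-i&0\end{pmatrix}$, $e_2\mapsto\begin{pmatrix}0&i\\i&0\end{pmatrix}$ (so $v\cdot v=-g(v,v)$). $S^{+}$ and $S^{-}$ are the eigenbundles of $\omega=s_1\cdot s_2$ for the eigenvalues $-1$ and $+1$ respectively. $\nabla^S$ is the spinor connection induced by the Levi-Civita connection. The Dirac operator is $D\varphi=-s_1\cdot\nabla^S_{s_1}\varphi+s_2\cdot\nabla^S_{s_2}\varphi$. A spinor $\varphi$ is harmonic if $D\varphi=0$, and twistor if $\nabla^S_V\varphi=-\tfrac12V\cdot D\varphi$ for all vector fields $V$. *)

(* Defs.v *)
From HB Require Import structures.
From mathcomp Require Import all_boot all_order all_algebra.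
From mathcomp Require Import complex.
From mathcomp Require Import all_classical all_reals all_analysis.

Set Implicit Arguments.
Unset Strict Implicit.
Unset Printing Implicit Defensive.

Import Order.TTheory GRing.Theory Num.Theory.
Import numFieldNormedType.Exports.

Local Open Scope classical_set_scope.
Local Open Scope ring_scope.

Definition basis_vec {R : realType} (a : 'I_2) : 'rV[R]_2 := delta_mx 0 a.

Fixpoint Ck_on {R : realType} (k : nat) (W : set 'rV[R]_2) (f : 'rV[R]_2 -> R)
    : Prop :=
  if k is k'.+1 then
    (forall y, W y -> differentiable f y) /\
    (forall a : 'I_2, Ck_on k' W (fun y => 'D_(basis_vec a) f y))
  else forall y, W y -> {for y, continuous f}.

Definition smooth_on {R : realType} (W : set 'rV[R]_2) (f : 'rV[R]_2 -> R) :=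
  forall k, Ck_on k W f.

(* The chart i is a homeomorphism chart_coord i from chart_dom i to the open set
   chart_coord i @` chart_dom i, with inverse chart_param i; the values of
   chart_coord i and chart_param i outside of these two sets are irrelevant.
   The orientation is given by an atlas all of whose coordinate changes
   preserve the orientation of R^2. *)
Record oriented_surface (R : realType) := OrientedSurface {
  carrier :> topologicalType;
  surface_hausdorff : hausdorff_space carrier;
  surface_second_countable : @second_countable carrier;
  chart : Type;
  chart_dom : chart -> set carrier;
  chart_coord : chart -> carrier -> 'rV[R]_2;
  chart_param : chart -> 'rV[R]_2 -> carrier;
  chart_at : carrier -> chart;
  chart_dom_open : forall i, open (chart_dom i);
  chart_codom_open : forall i, open (chart_coord i @` chart_dom i);
  chart_coordK : forall i x, chart_dom i x ->
    chart_param i (chart_coord i x) = x;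
  chart_coord_continuous : forall i,
    {within chart_dom i, continuous (chart_coord i)};
  chart_param_continuous : forall i,
    {within chart_coord i @` chart_dom i, continuous (chart_param i)};
  chart_at_dom : forall x, chart_dom (chart_at x) x;
  transition_smooth : forall i j (a : 'I_2),
    smooth_on (chart_coord i @` (chart_dom i `&` chart_dom j))
              (fun y => chart_coord j (chart_param i y) 0 a);
  transition_oriented : forall i j x, chart_dom i x -> chart_dom j x ->
    0 < \det (jacobian (chart_coord j \o chart_param i) (chart_coord i x))
}.

Arguments chart_dom {R o}.
Arguments chart_coord {R o}.
Arguments chart_param {R o}.
Arguments chart_at {R o}.

(* The tangent space at x is 'rV[R]_2, an element of which is the row of
   coordinates of a tangent vector with respect to the chart chart_at x.  Its
   coordinates in any other chart i around x are then obtained by applying the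
   differential of the change of coordinates from chart_at x to i; with row
   vectors, this is multiplication by transition_jac (chart_at x) i x on the
   right. *)
Definition transition_jac {R : realType} {M : oriented_surface R}
    (i j : chart M) (x : M) : 'M[R]_2 :=
  jacobian (chart_coord j \o chart_param i) (chart_coord i x).

Definition vf_coord {R : realType} {M : oriented_surface R}
    (V : M -> 'rV[R]_2) (i : chart M) (x : M) : 'rV[R]_2 :=
  V x *m transition_jac (chart_at x) i x.

Definition smooth_fun {R : realType} {M : oriented_surface R}
    (U : set M) (f : M -> R) :=
  forall i : chart M,
    smooth_on (chart_coord i @` (chart_dom i `&` U))
              (fun y => f (chart_param i y)).

Definition smooth_vf {R : realType} {M : oriented_surface R}
    (U : set M) (V : M -> 'rV[R]_2) :=
  forall (i : chart M) (a : 'I_2),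
    smooth_on (chart_coord i @` (chart_dom i `&` U))
              (fun y => vf_coord V i (chart_param i y) 0 a).

Definition dir_deriv {R : realType} {M : oriented_surface R}
    (x : M) (v : 'rV[R]_2) (f : M -> R) : R :=
  'D_v (fun y => f (chart_param (chart_at x) y)) (chart_coord (chart_at x) x).

Definition oriented_basis {R : realType} (v w : 'rV[R]_2) : Prop :=
  0 < \det (col_mx v w : 'M[R]_2).

Definition bilin {R : realType} (G : 'M[R]_2) (v w : 'rV[R]_2) : R :=
  (v *m G *m w^T) 0 0.

(* Given the Gram matrix G x of a bilinear form on each tangent space (in the
   coordinates of chart_at x), its Gram matrix in the coordinates of chart i. *)
Definition form_coord {R : realType} {M : oriented_surface R}
    (G : M -> 'M[R]_2) (i : chart M) (x : M) : 'M[R]_2 :=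
  transition_jac i (chart_at x) x *m G x *m (transition_jac i (chart_at x) x)^T.

Definition orthonormal_pair {R : realType} (G : 'M[R]_2) (s1 s2 : 'rV[R]_2) :=
  [/\ bilin G s1 s1 = -1, bilin G s2 s2 = 1 & bilin G s1 s2 = 0].

Record lorentzian_surface (R : realType) := LorentzianSurface {
  surface :> oriented_surface R;
  gram : surface -> 'M[R]_2;
  gram_sym : forall x, (gram x)^T = gram x;
  gram_signature : forall x, exists s1 s2, orthonormal_pair (gram x) s1 s2;
  gram_smooth : forall (i : chart surface) (a b : 'I_2),
    smooth_on (chart_coord i @` chart_dom i)
              (fun y => form_coord gram i (chart_param i y) a b)
}.

Section Lorentzian.
Variables (R : realType) (M : lorentzian_surface R).
Implicit Types (x : M) (v w : 'rV[R]_2) (V W : M -> 'rV[R]_2).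

Definition metric x v w : R := bilin (gram x) v w.

Definition spacelike x v := 0 < metric x v v.

Definition lightlike x v := v != 0 /\ metric x v v = 0.

Definition in_calX x v :=
  lightlike x v /\
  exists w, [/\ lightlike x w, oriented_basis v w & spacelike x (v + w)].

Definition in_calY x v := lightlike x v /\ ~ in_calX x v.

Definition local_vf (P : M -> 'rV[R]_2 -> Prop) (U : set M) V :=
  [/\ open U, smooth_vf U V & forall x, U x -> P x (V x)].

(* The Christoffel symbols Gamma^k_ab of the metric at x in the chart i:
   1/2 g^kl (d_a g_bl + d_b g_al - d_l g_ab). *)
Definition christoffel (i : chart M) x (k a b : 'I_2) : R :=
  let g y := form_coord (@gram R M) i (chart_param i y) in
  let dg c d e := 'D_(basis_vec c) (fun y => g y d e) (chart_coord i x) in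
  2^-1 * \sum_(l < 2)
    invmx (form_coord (@gram R M) i x) k l * (dg a b l + dg b a l - dg l a b).

(* The Levi-Civita covariant derivative of W at x along the tangent vector v,
   computed in the chart chart_at x. *)
Definition levi_civita x v W : 'rV[R]_2 :=
  \row_k (dir_deriv x v (fun y => vf_coord W (chart_at x) y 0 k) +
          \sum_(a < 2) \sum_(b < 2)
            christoffel (chart_at x) x k a b * v 0 a * W x 0 b).

End Lorentzian.

Definition cliff1 {R : realType} : 'M[R[i]]_2 :=
  ('i)%C *: (delta_mx 0 1 - delta_mx 1 0).

Definition cliff2 {R : realType} : 'M[R[i]]_2 :=
  ('i)%C *: (delta_mx 0 1 + delta_mx 1 0).

Definition cliff {R : realType} (a : 'rV[R]_2) : 'M[R[i]]_2 :=
  (a 0 0)%:C%C *: cliff1 + (a 0 1)%:C%C *: cliff2.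

(* Products of an even number of vectors a of R^{1,1} with <a, a> = 1 or -1.
   This is the two-fold cover of the whole of SO(1,1), not only of its identity
   component: surfaces are oriented, but not time-oriented. *)
Definition Spin11 {R : realType} : set 'M[R[i]]_2 :=
  [set A | exists s : seq 'rV[R]_2,
    [/\ ~~ odd (size s),
        (forall a, a \in s -> `| - (a 0 0) ^+ 2 + (a 0 1) ^+ 2 | = 1)
      & A = \big[mulmx/1%:M]_(a <- s) cliff a]].

(* L is the image of A under the covering Spin(1,1) -> SO(1,1): the rows of L
   are the images of the basis vectors under conjugation by A. *)
Definition spin_cover {R : realType} (A : 'M[R[i]]_2) (L : 'M[R]_2) :=
  forall j : 'I_2, cliff (row j L) = A *m cliff (basis_vec j) *m invmx A.

(* A principal Spin(1,1)-bundle spin_proj : spin_total -> M with an equivariant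
   continuous map to the bundle of oriented orthonormal frames; this map sends
   q to the frame (row 0 (spin_frame q), row 1 (spin_frame q)) of the tangent
   space at spin_proj q.  Equivariance makes it a two-fold covering.  Only the
   values of spin_act at elements of Spin11 are relevant.  (R[i]^o is R[i] with
   its usual topology.) *)
Record spin_structure (R : realType) (M : lorentzian_surface R) :=
    SpinStructure {
  spin_total :> topologicalType;
  spin_proj : spin_total -> M;
  spin_act : spin_total -> 'M[R[i]]_2 -> spin_total;
  spin_frame : spin_total -> 'M[R]_2;
  spin_proj_continuous : continuous spin_proj;
  spin_act_proj : forall q A, Spin11 A ->
    spin_proj (spin_act q A) = spin_proj q;
  spin_act1 : forall q, spin_act q 1%:M = q;
  spin_actM : forall q A B, Spin11 A -> Spin11 B ->
    spin_act (spin_act q A) B = spin_act q (A *m B);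
  spin_act_free : forall q A, Spin11 A -> spin_act q A = q -> A = 1%:M;
  spin_act_transitive : forall q q', spin_proj q = spin_proj q' ->
    exists2 A, Spin11 A & q' = spin_act q A;
  spin_locally_trivial : forall x : M,
    exists (U : set M) (sigma : M -> spin_total)
           (tau : spin_total -> 'M[R[i]^o]_2),
    [/\ open U /\ U x,
        (forall y, U y -> spin_proj (sigma y) = y),
        {within [set p : M * 'M[R[i]^o]_2 | U p.1 /\ Spin11 p.2],
          continuous (fun p : M * 'M[R[i]^o]_2 => spin_act (sigma p.1) p.2)},
        {within spin_proj @^-1` U, continuous tau}
      & forall q, U (spin_proj q) ->
          Spin11 (tau q) /\ q = spin_act (sigma (spin_proj q)) (tau q)];
  spin_frame_orthonormal : forall q,
    orthonormal_pair (gram (spin_proj q))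
      (row 0 (spin_frame q)) (row 1 (spin_frame q));
  spin_frame_oriented : forall q,
    oriented_basis (row 0 (spin_frame q)) (row 1 (spin_frame q));
  spin_frame_continuous : forall i : chart M,
    {within spin_proj @^-1` chart_dom i, continuous (fun q =>
      spin_frame q *m
        transition_jac (chart_at (spin_proj q)) i (spin_proj q))};
  spin_frame_equivariant : forall q A, Spin11 A ->
    exists2 L, spin_cover A L & spin_frame (spin_act q A) = L *m spin_frame q
}.

Section Spinors.
Variables (R : realType) (M : lorentzian_surface R) (Q : spin_structure M).
Implicit Types (x : M) (v : 'rV[R]_2) (q : Q) (sigma : M -> Q).
Implicit Types (phi : Q -> 'cV[R[i]]_2).

(* The frame (s_1, s_2) underlying a local section of Q: s_1 is frame sigma 0
   and s_2 is frame sigma 1. *)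
Definition frame sigma (j : 'I_2) x : 'rV[R]_2 := row j (spin_frame (sigma x)).

(* Smooth local sections of Q over U.  The smooth structure of Q is the one for
   which the covering of the frame bundle is a local diffeomorphism, so that a
   section is smooth when it is continuous and its frame is smooth. *)
Definition spin_section (U : set M) sigma :=
  [/\ open U, (forall x, U x -> spin_proj (sigma x) = x),
      {within U, continuous sigma}
    & forall j : 'I_2, smooth_vf U (frame sigma j)].

(* A section of S = Q x_Spin C^2 is encoded as a Spin(1,1)-equivariant map
   phi : Q -> C^2; its value at x is the class [q, phi q] for all q over x. *)
Definition spinor_field phi :=
  (forall q A, Spin11 A -> phi (spin_act q A) = invmx A *m phi q) /\
  (forall U sigma, spin_section U sigma -> forall k : 'I_2,
     smooth_fun U (fun x => complex.Re (phi (sigma x) k 0)) /\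
     smooth_fun U (fun x => complex.Im (phi (sigma x) k 0))).

(* omega = s_1 . s_2 acts on [q, z] as [q, cliff1 * cliff2 * z]. *)
Definition spinor_plus phi :=
  spinor_field phi /\ forall q, cliff1 *m cliff2 *m phi q = - phi q.

Definition spinor_minus phi :=
  spinor_field phi /\ forall q, cliff1 *m cliff2 *m phi q = phi q.

(* Below, a spinor over x is represented by its component z in C^2 with respect
   to a local section sigma of Q, i.e., it is [sigma x, z]. *)

(* Clifford multiplication by the tangent vector v, whose coordinates in the
   frame (s_1, s_2) are - g(v, s_1) and g(v, s_2). *)
Definition cliff_mul sigma x v (z : 'cV[R[i]]_2) : 'cV[R[i]]_2 :=
  let a := \row_(j < 2) (if j == 0 then - metric x v (frame sigma 0 x)
                         else metric x v (frame sigma 1 x)) in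
  cliff a *m z.

(* The spinor derivative: nabla^S_v [sigma, z]
     = [sigma, v(z) - 1/2 g(nabla_v s_1, s_2) s_1 . s_2 . z].
   The coefficient is eps_1 eps_2 / 2 with eps_j = g(s_j, s_j); it makes
   Clifford multiplication parallel. *)
Definition nablaS sigma phi x v : 'cV[R[i]]_2 :=
  (\col_k Complex (dir_deriv x v (fun y => complex.Re (phi (sigma y) k 0)))
                  (dir_deriv x v (fun y => complex.Im (phi (sigma y) k 0))))
  - (2^-1 * metric x (levi_civita x v (frame sigma 0)) (frame sigma 1 x))%:C%C
      *: (cliff1 *m cliff2 *m phi (sigma x)).

Definition dirac sigma phi x : 'cV[R[i]]_2 :=
  - cliff_mul sigma x (frame sigma 0 x) (nablaS sigma phi x (frame sigma 0 x))
  + cliff_mul sigma x (frame sigma 1 x) (nablaS sigma phi x (frame sigma 1 x)).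

(* A spinor vanishes, or two spinors agree, iff their components do so with
   respect to every local section of Q. *)
Definition is_harmonic phi :=
  forall U sigma, spin_section U sigma ->
  forall x, U x -> dirac sigma phi x = 0.

Definition is_twistor phi :=
  forall W V, local_vf (fun _ _ => True) W V ->
  forall U sigma, spin_section U sigma ->
  forall x, W x -> U x ->
    nablaS sigma phi x (V x)
    = - (2^-1 *: cliff_mul sigma x (V x) (dirac sigma phi x)).

Definition parallel_along (P : M -> 'rV[R]_2 -> Prop) phi :=
  forall W V, local_vf P W V ->
  forall U sigma, spin_section U sigma ->
  forall x, W x -> U x -> nablaS sigma phi x (V x) = 0.

End Spinors.

(* Main.v *)
Require Import Defs.
From mathcomp Require Import all_boot all_order all_algebra complex.
From mathcomp Require Import all_classical all_reals all_analysis.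
From mathcomp Require Import ring lra.

(** In the lightlike frame [X = s_1 + s_2], [Y = - s_1 + s_2], Clifford
    multiplication by [X] (resp. [Y]) is [2 i] times the elementary matrix with
    entry (0, 1) (resp. (1, 0)), and [S^+], [S^-] are the two coordinate lines
    of C^2.  Hence [D phi = i ((nabla_Y phi)_1, (nabla_X phi)_0)] and, for
    [V = a X + b Y], [- 1/2 V . D phi = (a (nabla_X phi)_0, b (nabla_Y phi)_1)].
    So harmonicity is the vanishing of [(nabla_X phi)_0] and [(nabla_Y phi)_1],
    and the twistor equation that of [(nabla_Y phi)_0] and [(nabla_X phi)_1]. *)

Set Implicit Arguments.
Unset Strict Implicit.
Unset Printing Implicit Defensive.

Import Order.TTheory GRing.Theory Num.Theory.
Import numFieldNormedType.Exports.

Local Open Scope classical_set_scope.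
Local Open Scope ring_scope.

(** * Smooth functions on open subsets of the plane *)

Lemma near_eq_differentiable (R : numFieldType) (V W : normedModType R)
    (f g : V -> W) (x : V) :
  {near x, f =1 g} -> differentiable f x -> differentiable g x.
Proof.
move=> fg df; have cdf := diff_continuous df.
(* The first-order expansion of [f] at [x] is one of [g], so by uniqueness ['d f x] is the
   differential of [g]. *)
have dg : g \o shift x = cst (g x) + 'd f x +o_ 0 id.
  apply/eqaddoP => e e0.
  have /eqaddoP/(_ e e0) H := diff_locally df.
  have fgs : \forall h \near 0, f (h + x) = g (h + x).
    move: fg; rewrite /prop_near1 nbhsE /= => -[B [oB Bx] fgB].
    have : \forall h \near (0 : V), B (h + x).
      have : (fun h : V => h + x) @ (0 : V) --> 0 + x.
        by apply: cvgD; [exact: cvg_id|exact: cvg_cst].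
      by rewrite add0r; apply; exact: open_nbhs_nbhs.
    by apply: filterS => h; exact: fgB.
  move: H fgs; apply: filterS2 => h + fgh.
  by rewrite !fctE /= fgh (nbhs_singleton fg).
apply/diff_locallyP.
have E : 'd g x = 'd f x :> (V -> W) by exact: diff_unique.
by rewrite E.
Qed.

Section SmoothOn.
Variable R : realType.
Implicit Types (W : set 'rV[R]_2) (f g : 'rV[R]_2 -> R).

(** As [W] is open, agreement on [W] is agreement near each of its points. The partial derivatives
    then agree on [W] too, and the induction continues with them. *)
Lemma Ck_on_eq k W f g :
  open W -> (forall y, W y -> f y = g y) -> Ck_on k W f -> Ck_on k W g.
Proof.
move=> oW; elim: k f g => [|k IH] f g fg /=.
  move=> cf y Wy; have /near_eq_cvg H : {near y, f =1 g}.
    by move: (open_nbhs_nbhs (conj oW Wy)); apply: filterS => z /fg.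
  rewrite /prop_for /continuous_at -fg//.
  exact: cvg_trans H (cf y Wy).
have near_fg y : W y -> {near y, f =1 g}.
  by move=> Wy; move: (open_nbhs_nbhs (conj oW Wy)); apply: filterS => z /fg.
case=> df Cf; split=> [y Wy|a].
  exact: near_eq_differentiable (near_fg y Wy) (df y Wy).
by apply: IH (Cf a) => y Wy; apply: near_eq_derive; exact: near_fg.
Qed.

Lemma Ck_on_comb k W f g (a : R) : open W -> Ck_on k W f -> Ck_on k W g ->
  Ck_on k W (fun y => a * f y + g y).
Proof.
move=> oW; elim: k f g => [|k IH] f g /=.
  move=> cf cg y Wy; apply: cvgD (cg y Wy).
  by apply: cvgM (cf y Wy); exact: cvg_cst.
move=> [df Cf] [dg Cg]; split=> [y Wy|b].
  exact: differentiableD (differentiableZ a (df y Wy)) (dg y Wy).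
(* The derivative of the combination is known to be the combination of the derivatives only on [W],
   where [f] and [g] are differentiable. *)
apply: Ck_on_eq (IH _ _ (Cf b) (Cg b)) => // y Wy.
have dfb : derivable f y (basis_vec b) by exact/diff_derivable/df.
have dgb : derivable g y (basis_vec b) by exact/diff_derivable/dg.
by rewrite (deriveD (derivableZ (k := a) dfb) dgb) deriveZ.
Qed.

End SmoothOn.

(** * Vector fields and directional derivatives on a surface *)

Section Fields.
Variables (R : realType) (M : oriented_surface R).
Implicit Types (x : M) (U : set M) (V W : M -> 'rV[R]_2).

(** The image is the part of the open chart codomain that the continuous map [chart_param i] sends
    into [U]. *)
Lemma open_chart_image (i : chart M) U :
  open U -> open (chart_coord i @` (chart_dom i `&` U)).
Proof.
move=> oU; have oC := @chart_codom_open R M i.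
have := @chart_param_continuous R M i.
rewrite continuous_open_subspace// => /(continuous_inP _ oC)/(_ U oU).
congr open; apply/seteqP; split=> [y [[x dx <-] /=]|_ [x [dx Ux] <-]].
  by rewrite chart_coordK// => Ux; exists x.
by split; [exists x|rewrite /= chart_coordK].
Qed.

Lemma smooth_vf_comb U V W (a : R) : open U -> smooth_vf U V ->
  smooth_vf U W -> smooth_vf U (fun x => a *: V x + W x).
Proof.
move=> oU sV sW i b k.
have := Ck_on_comb a (open_chart_image oU) (sV i b k) (sW i b k).
congr (Ck_on _ _ _); apply/funext => y.
by rewrite /vf_coord mulmxDl -scalemxAl !mxE.
Qed.

(** Differentiability turns the directional derivative into the value of a linear map, the
    differential. *)
Lemma dir_deriv_comb x (a b : R) (v w : 'rV[R]_2) (f : M -> R) :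
  differentiable (fun y => f (chart_param (chart_at x) y))
    (chart_coord (chart_at x) x) ->
  dir_deriv x (a *: v + b *: w) f = a * dir_deriv x v f + b * dir_deriv x w f.
Proof. by move=> df; rewrite /dir_deriv !deriveE// linearD !linearZ. Qed.

Lemma smooth_fun_differentiable U (f : M -> R) x : smooth_fun U f -> U x ->
  differentiable (fun y => f (chart_param (chart_at x) y))
    (chart_coord (chart_at x) x).
Proof.
move=> sf Ux; have [df _] := sf (chart_at x) 1; apply: df.
by exists x => //; split => //; exact: chart_at_dom.
Qed.

Lemma smooth_vf_differentiable U V x (k : 'I_2) : smooth_vf U V -> U x ->
  differentiable
    (fun y => vf_coord V (chart_at x) (chart_param (chart_at x) y) 0 k)
    (chart_coord (chart_at x) x).
Proof.
move=> sV Ux; have [dV _] := sV (chart_at x) k 1; apply: dV.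
by exists x => //; split => //; exact: chart_at_dom.
Qed.

End Fields.

(** * Bilinear forms and determinants in dimension two *)

Section Bilin.
Variables (R : realType) (G : 'M[R]_2).
Implicit Types (u v w : 'rV[R]_2) (a b : R).

Lemma bilin_combl a b u v w :
  bilin G (a *: u + b *: v) w = a * bilin G u w + b * bilin G v w.
Proof. by rewrite /bilin !mulmxDl -!scalemxAl !mxE. Qed.

Lemma bilin_combr a b u v w :
  bilin G w (a *: u + b *: v) = a * bilin G w u + b * bilin G w v.
Proof. by rewrite /bilin linearD !linearZ /= mulmxDr -!scalemxAr !mxE. Qed.

Lemma bilinC v w : G^T = G -> bilin G v w = bilin G w v.
Proof.
move=> Gs; rewrite /bilin -[in RHS]Gs -[in RHS](trmxK w) -!trmx_mul mulmxA.
by rewrite [in RHS]mxE.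
Qed.

End Bilin.

Lemma det_mx2 (R : comNzRingType) (A : 'M[R]_2) :
  \det A = A 0 0 * A 1 1 - A 0 1 * A 1 0.
Proof.
rewrite (expand_det_row _ 0) big_ord_recl big_ord1 /cofactor !det_mx11 !mxE.
have -> : lift ord0 ord0 = 1 :> 'I_2 by exact: val_inj.
have -> : lift 1 0 = 0 :> 'I_2 by exact: val_inj.
by rewrite expr0 expr1 mul1r mulN1r mulrN.
Qed.

(** * Null coordinates in a Lorentzian plane *)

Section LightCone.
Variables (R : realType) (G : 'M[R]_2) (s1 s2 : 'rV[R]_2).
Hypothesis G_sym : G^T = G.
Hypothesis s_orthonormal : orthonormal_pair G s1 s2.
Hypothesis s_oriented : oriented_basis s1 s2.
Implicit Types (v w : 'rV[R]_2) (a b c d : R).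

Lemma oriented_basisE v w :
  oriented_basis v w = (0 < v 0 0 * w 0 1 - v 0 1 * w 0 0) :> Prop.
Proof.
have E0 j : col_mx v w (0 : 'I_2) j = v 0 j.
  by rewrite -(col_mxEu v w 0 j); congr (col_mx v w _ j); exact: val_inj.
have E1 j : col_mx v w (1 : 'I_2) j = w 0 j.
  by rewrite -(col_mxEd v w 0 j); congr (col_mx v w _ j); exact: val_inj.
by rewrite /oriented_basis det_mx2 !E0 !E1.
Qed.

Lemma frame_decomposition v :
  exists a b, v = a *: (s1 + s2) + b *: (- s1 + s2).
Proof.
have j2 (j : 'I_2) : j = 0 \/ j = 1.
  by case: j => -[|[|//]] ?; [left|right]; exact: val_inj.
have : s1 0 0 * s2 0 1 - s1 0 1 * s2 0 0 != 0.
  by move: s_oriented; rewrite oriented_basisE => /lt0r_neq0.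
set d := _ - _ => d0.
(* Cramer's rule: [c1] and [c2] are the coordinates of [v] in the basis [(s1, s2)]. The null
   coordinates then solve a - b = [c1] and a + b = [c2]. *)
pose c1 := (v 0 0 * s2 0 1 - v 0 1 * s2 0 0) / d.
pose c2 := (s1 0 0 * v 0 1 - s1 0 1 * v 0 0) / d.
have vE j : v 0 j = c1 * s1 0 j + c2 * s2 0 j.
  apply: (mulIf d0); rewrite mulrDl (mulrAC c1) (mulrAC c2) !divfK// /d.
  by case: (j2 j) => ->; ring.
exists ((c1 + c2) / 2), ((c2 - c1) / 2); apply/rowP => j; rewrite !mxE vE.
by move: c1 c2 {vE} => c1 c2; field.
Qed.

(** With X = s1 + s2 and Y = - s1 + s2, both are null and g(X, Y) = 2, so only the mixed products
    survive. *)
Lemma bilin_null a b c d :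
  bilin G (a *: (s1 + s2) + b *: (- s1 + s2))
          (c *: (s1 + s2) + d *: (- s1 + s2)) = 2 * (a * d + b * c).
Proof.
have [g11 g22 g12] := s_orthonormal.
have X : s1 + s2 = 1 *: s1 + 1 *: s2 by rewrite !scale1r.
have Y : - s1 + s2 = (-1) *: s1 + 1 *: s2 by rewrite scaleN1r scale1r.
rewrite X Y !(bilin_combl, bilin_combr) (bilinC s2 s1 G_sym) g11 g22 g12; ring.
Qed.

Lemma oriented_basis_null a b c d :
  oriented_basis (a *: (s1 + s2) + b *: (- s1 + s2))
                 (c *: (s1 + s2) + d *: (- s1 + s2))
  = (0 < a * d - b * c) :> Prop.
Proof.
rewrite oriented_basisE !mxE.
(* The determinant of (X, Y) is 2 [e], which is positive, so null coordinates detect orientation. *)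
set e := s1 0 0 * s2 0 1 - s1 0 1 * s2 0 0.
have e0 : 0 < 2 * e.
  by move: s_oriented; rewrite oriented_basisE => ?; rewrite mulr_gt0.
rewrite -(pmulr_rgt0 (a * d - b * c) e0); congr (is_true (0 < _)).
rewrite /e; ring.
Qed.

Lemma null_comb_eq0 a b :
  a *: (s1 + s2) + b *: (- s1 + s2) = 0 -> a = 0 /\ b = 0.
Proof.
(* Pairing the vector with X gives 2 b, and with Y gives 2 a. *)
move=> v0; have := bilin_null a b 1 0; have := bilin_null a b 0 1.
by rewrite v0 /bilin !mul0mx mxE; lra.
Qed.

End LightCone.

(** * The two lightlike distributions in null coordinates *)

Section Distributions.
Variables (R : realType) (M : lorentzian_surface R) (x : M).
Variables (s1 s2 : 'rV[R]_2).
Hypothesis s_orthonormal : orthonormal_pair (gram x) s1 s2.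
Hypothesis s_oriented : oriented_basis s1 s2.
Implicit Types (v w : 'rV[R]_2) (a b : R).

Let g_null := bilin_null (gram_sym x) s_orthonormal.
Let o_null := oriented_basis_null s_oriented.
Let null_eq0 := null_comb_eq0 (gram_sym x) s_orthonormal.

(** The squared length of a X + b Y is 4 a b. *)
Lemma lightlike_null a b :
  lightlike x (a *: (s1 + s2) + b *: (- s1 + s2)) <->
  (a != 0 /\ b = 0) \/ (a = 0 /\ b != 0).
Proof.
rewrite /lightlike /metric g_null; split=> [[v0 ab]|ab].
  have /eqP : a * b = 0 by lra.
  rewrite mulf_eq0 => /orP[]/eqP c0; [right|left]; split=> //; subst;
  by apply: contra_neq v0 => ->; rewrite !scale0r addr0.
split; last by case: ab => -[? ?]; subst; ring.
by apply/eqP => /null_eq0[a0 b0]; case: ab => -[]; rewrite ?a0 ?b0 eqxx.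
Qed.

Lemma in_calX_null a b :
  in_calX x (a *: (s1 + s2) + b *: (- s1 + s2)) <-> a != 0 /\ b = 0.
Proof.
rewrite /in_calX lightlike_null; split.
  case=> -[//|[-> b0]] [w]; have [c [d ->]] := frame_decomposition s_oriented w.
  (* For v = b Y and w = c X + d Y, orientation means b c < 0, hence c is nonzero and d = 0 as w is
     lightlike. But v + w spacelike then means b c > 0. *)
  rewrite o_null /spacelike /metric addrACA -!scalerDl g_null !add0r.
  by move=> [/lightlike_null[][? ?]]; subst; lra.
move=> [a0 ->]; split; first by left.
(* For v = a X the partner is a Y: the orientation condition becomes a^2 > 0, and v + w has squared
   length 4 a^2. *)
exists (0 *: (s1 + s2) + a *: (- s1 + s2)).
have aa : 0 < a * a by rewrite -expr2 exprn_even_gt0.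
rewrite o_null /spacelike /metric addrACA -!scalerDl g_null.
by split; [apply/lightlike_null; right| |]; rewrite ?addr0 ?add0r; lra.
Qed.

Lemma in_calY_null a b :
  in_calY x (a *: (s1 + s2) + b *: (- s1 + s2)) <-> a = 0 /\ b != 0.
Proof.
rewrite /in_calY in_calX_null lightlike_null; split=> [[[]]//|[-> b0]].
by split; [right|case; rewrite eqxx].
Qed.

End Distributions.

(** * Clifford multiplication on C^2 *)

Lemma colP2 (T : Type) (z w : 'cV[T]_2) :
  z 0 0 = w 0 0 -> z 1 0 = w 1 0 -> z = w.
Proof.
move=> z0 z1; apply/colP => -[[|[|//]] lt2].
  by rewrite (_ : Ordinal lt2 = 0) //; exact: val_inj.
by rewrite (_ : Ordinal lt2 = 1) //; exact: val_inj.
Qed.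

Lemma comb_colE (K : pzRingType) n (a b : K) (z w : 'cV[K]_n) k :
  (a *: z + b *: w) k 0 = a * z k 0 + b * w k 0.
Proof. by rewrite !mxE. Qed.

Section Clifford.
Variable R : realType.

Lemma cliffE (a : 'rV[R]_2) (z : 'cV[R[i]]_2) :
  ((cliff a *m z) 0 0 = 'i%C * (a 0 0 + a 0 1)%:C%C * z 1 0) *
  ((cliff a *m z) 1 0 = 'i%C * (a 0 1 - a 0 0)%:C%C * z 0 0).
Proof.
have E k : (cliff a *m z) k 0 = cliff a k 0 * z 0 0 + cliff a k 1 * z 1 0.
  rewrite mxE big_ord_recl big_ord1.
  by have -> : lift ord0 ord0 = 1 :> 'I_2 by exact: val_inj.
rewrite !E /cliff /cliff1 /cliff2 !mxE /= rmorphD rmorphB /=.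
by split; ring.
Qed.

(** omega is diag(-1, 1), so S^+ is the line of coordinate 0 and S^- that of coordinate 1. *)
Lemma volumeE (z : 'cV[R[i]]_2) :
  ((cliff1 *m cliff2 *m z) 0 0 = - z 0 0) *
  ((cliff1 *m cliff2 *m z) 1 0 = z 1 0).
Proof.
have c1 : cliff1 = cliff (basis_vec 0) :> 'M[R[i]]_2.
  by rewrite /cliff /basis_vec !mxE /= scale1r scale0r addr0.
have c2 : cliff2 = cliff (basis_vec 1) :> 'M[R[i]]_2.
  by rewrite /cliff /basis_vec !mxE /= scale1r scale0r add0r.
rewrite -mulmxA c1 c2 !cliffE /basis_vec !mxE /=.
by rewrite addr0 subr0 !add0r rmorphN !rmorph1 !mulr1 mulrN1 mulNr !mulrA
  -expr2 sqr_i !mulN1r opprK.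
Qed.

(** To be read with V = a X + b Y, [N], [NX], [NY] the derivatives of phi along V, X, Y, [D] its
    Dirac image and [C] = V . [D]. The right-hand side already matches a [NX] in coordinate 0 and b
    [NY] in coordinate 1; the other two terms must vanish. *)
Lemma twistor_algebra (a b : R) (N NX NY C D : 'cV[R[i]]_2) :
  N = a%:C%C *: NX + b%:C%C *: NY ->
  (C 0 0 = 'i%C * (2 * a)%:C%C * D 1 0) *
  (C 1 0 = 'i%C * (2 * b)%:C%C * D 0 0) ->
  (D 0 0 = 'i%C * NY 1 0) * (D 1 0 = 'i%C * NX 0 0) ->
  N = - (2^-1 *: C) <-> b%:C%C * NY 0 0 = 0 /\ a%:C%C * NX 1 0 = 0.
Proof.
move=> -> [C0 C1] [D0 D1].
have half (c : R) (z : R[i]) :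
    - (2^-1 * ('i%C * (2 * c)%:C%C * ('i%C * z))) = c%:C%C * z.
  by rewrite rmorphM rmorph_nat mulrACA -expr2 sqr_i; field.
have RE k : (- (2^-1 *: C)) k 0 = - (2^-1 * C k 0) by rewrite !mxE.
split=> [E|[E0 E1]].
  have := congr1 (fun z : 'cV_2 => z 0 0) E.
  have := congr1 (fun z : 'cV_2 => z 1 0) E.
  rewrite !RE !comb_colE C0 C1 D0 D1 !half.
  move=> /(canRL (addrK _)); rewrite subrr => ->.
  by move=> /(canRL (addKr _)); rewrite addNr => ->.
apply: colP2; rewrite RE comb_colE ?C0 ?C1 ?D0 ?D1 half ?E0 ?E1.
  by rewrite addr0.
by rewrite add0r.
Qed.

End Clifford.

(** * The spinor derivative and the Dirac operator in the null frame *)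

Section Spinors.
Variables (R : realType) (M : lorentzian_surface R) (Q : spin_structure M).
Variables (U : set M) (sigma : M -> Q).
Hypothesis sec : spin_section U sigma.
Implicit Types (x : M) (v w : 'rV[R]_2) (phi : Q -> 'cV[R[i]]_2).

Definition X_frame x := frame sigma 0 x + frame sigma 1 x.
Definition Y_frame x := - frame sigma 0 x + frame sigma 1 x.

Lemma frame_orthonormal x : U x ->
  orthonormal_pair (gram x) (frame sigma 0 x) (frame sigma 1 x).
Proof.
case: sec => _ proj _ _ /proj Ux.
by have := spin_frame_orthonormal (sigma x); rewrite Ux.
Qed.

Lemma frame_oriented x : oriented_basis (frame sigma 0 x) (frame sigma 1 x).
Proof. exact: spin_frame_oriented. Qed.

Lemma in_calX_comb x a b : U x ->
  in_calX x (a *: X_frame x + b *: Y_frame x) <-> a != 0 /\ b = 0.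
Proof.
by move=> Ux; exact: in_calX_null (frame_orthonormal Ux) (frame_oriented x) a b.
Qed.

Lemma in_calY_comb x a b : U x ->
  in_calY x (a *: X_frame x + b *: Y_frame x) <-> a = 0 /\ b != 0.
Proof.
by move=> Ux; exact: in_calY_null (frame_orthonormal Ux) (frame_oriented x) a b.
Qed.

Lemma smooth_X_frame : smooth_vf U X_frame.
Proof.
case: sec => oU _ _ sF.
have := smooth_vf_comb 1 oU (sF 0) (sF 1).
by congr smooth_vf; apply/funext => x; rewrite scale1r.
Qed.

Lemma smooth_Y_frame : smooth_vf U Y_frame.
Proof.
case: sec => oU _ _ sF.
have := smooth_vf_comb (-1) oU (sF 0) (sF 1).
by congr smooth_vf; apply/funext => x; rewrite scaleN1r.
Qed.

(** This makes the frame field itself a test field for [parallel_along]. *)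
Lemma local_vf_X_frame : local_vf (@in_calX R M) U X_frame.
Proof.
split; [by case: sec|exact: smooth_X_frame|move=> x Ux].
have -> : X_frame x = 1 *: X_frame x + 0 *: Y_frame x.
  by rewrite scale1r scale0r addr0.
by rewrite in_calX_comb// oner_neq0.
Qed.

Lemma local_vf_Y_frame : local_vf (@in_calY R M) U Y_frame.
Proof.
split; [by case: sec|exact: smooth_Y_frame|move=> x Ux].
have -> : Y_frame x = 0 *: X_frame x + 1 *: Y_frame x.
  by rewrite scale1r scale0r add0r.
by rewrite in_calY_comb// oner_neq0.
Qed.

Lemma levi_civita_comb x V (a b : R) v w : smooth_vf U V -> U x ->
  levi_civita x (a *: v + b *: w) V
  = a *: levi_civita x v V + b *: levi_civita x w V.
Proof.
move=> sV Ux; apply/rowP => k; rewrite !mxE dir_deriv_comb; last first.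
  exact: smooth_vf_differentiable sV Ux.
rewrite !mulrDr addrACA; congr (_ + _).
(* What remains is linear in the direction for any coefficients in place of the Christoffel
   symbols. *)
move: (christoffel _ x k) => C.
rewrite !mulr_sumr -big_split; apply: eq_bigr => c _ /=.
rewrite !mulr_sumr -big_split; apply: eq_bigr => d _ /=.
by rewrite !mxE; ring.
Qed.

(* The name [F] keeps rewriting from comparing instances of [nablaS] up to
   conversion, which is very slow. *)
Lemma nablaSE phi x k :
  exists2 F : 'rV[R]_2 -> R[i], (forall v, nablaS sigma phi x v k 0 = F v) &
  exists z, forall v, F v =
    Complex (dir_deriv x v (fun y => complex.Re (phi (sigma y) k 0)))
            (dir_deriv x v (fun y => complex.Im (phi (sigma y) k 0)))
    - (2^-1 * metric x (levi_civita x v (frame sigma 0))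
                       (frame sigma 1 x))%:C%C * z.
Proof.
exists (fun v => nablaS sigma phi x v k 0) => //.
exists ((cliff1 *m cliff2 *m phi (sigma x)) k 0) => v.
by rewrite /nablaS mxE [X in _ + X]mxE [X in - X]mxE mxE.
Qed.

(** Smoothness of the components of phi and of the frame makes both the derivative term and the
    connection term linear in the direction. *)
Lemma nablaS_comb phi x (a b : R) v w : spinor_field phi -> U x ->
  nablaS sigma phi x (a *: v + b *: w)
  = a%:C%C *: nablaS sigma phi x v + b%:C%C *: nablaS sigma phi x w.
Proof.
move=> [_ /(_ U sigma sec) sphi] Ux; case: sec => _ _ _ /(_ 0) sF.
apply/colP => k; have [sRe sIm] := sphi k.
rewrite [RHS]comb_colE; have [F NF [z Fz]] := nablaSE phi x k.
apply: etrans (NF _) _; transitivity (a%:C%C * F v + b%:C%C * F w); last first.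
  by congr (_ * _ + _ * _); exact: esym (NF _).
rewrite !{}Fz.
rewrite (levi_civita_comb _ _ _ _ sF Ux) /metric bilin_combl.
rewrite (dir_deriv_comb _ _ _ _ (smooth_fun_differentiable sRe Ux)).
rewrite (dir_deriv_comb _ _ _ _ (smooth_fun_differentiable sIm Ux)).
have C (p q p' q' : R) : Complex (a * p + b * q) (a * p' + b * q')
    = a%:C%C * Complex p p' + b%:C%C * Complex q q'.
  by apply/eqP; rewrite eq_complex /=; apply/andP; split; apply/eqP; ring.
rewrite C mulrDr !rmorphD !rmorphM /=; ring.
Qed.

Lemma cliff_mulE x (a b : R) (z : 'cV[R[i]]_2) : U x ->
  (cliff_mul sigma x (a *: X_frame x + b *: Y_frame x) z 0 0
     = 'i%C * (2 * a)%:C%C * z 1 0) *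
  (cliff_mul sigma x (a *: X_frame x + b *: Y_frame x) z 1 0
     = 'i%C * (2 * b)%:C%C * z 0 0).
Proof.
move=> Ux; rewrite /cliff_mul !cliffE !mxE /=.
have [g11 g22 g12] := frame_orthonormal Ux.
have g21 : bilin (gram x) (frame sigma 1 x) (frame sigma 0 x) = 0.
  by rewrite bilinC ?gram_sym.
(* The coordinates in (s_1, s_2) are (a - b, a + b); their sum 2 a and difference 2 b are the
   entries of the Clifford matrix, up to i. *)
have -> : a *: X_frame x + b *: Y_frame x
    = (a - b) *: frame sigma 0 x + (a + b) *: frame sigma 1 x.
  by apply/rowP => k; rewrite !mxE; ring.
rewrite /metric !bilin_combl g11 g22 g12 g21.
by split; congr (_ * _%:C%C * _); ring.
Qed.

Lemma frame0E (x : M) :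
  frame sigma 0 x = 2^-1 *: X_frame x + (- 2^-1) *: Y_frame x.
Proof. by apply/rowP => k; rewrite !mxE; field. Qed.

Lemma frame1E (x : M) :
  frame sigma 1 x = 2^-1 *: X_frame x + 2^-1 *: Y_frame x.
Proof. by apply/rowP => k; rewrite !mxE; field. Qed.

Lemma diracE phi x : spinor_field phi -> U x ->
  (Defs.dirac sigma phi x 0 0 = 'i%C * nablaS sigma phi x (Y_frame x) 1 0) *
  (Defs.dirac sigma phi x 1 0 = 'i%C * nablaS sigma phi x (X_frame x) 0 0).
Proof.
move=> fphi Ux; rewrite /Defs.dirac.
have -> : X_frame x = 1 *: frame sigma 0 x + 1 *: frame sigma 1 x.
  by rewrite !scale1r.
have -> : Y_frame x = (-1) *: frame sigma 0 x + 1 *: frame sigma 1 x.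
  by rewrite scaleN1r scale1r.
rewrite !nablaS_comb// rmorphN rmorph1.
(* With the derivatives along s_1 and s_2 abstracted, passing to the null frame affects only the
   Clifford factors. *)
move: (nablaS _ _ _ _) (nablaS _ _ _ _) => N1 N0.
rewrite frame0E frame1E.
have c0 := cliff_mulE 2^-1 (- 2^-1) N0 Ux.
have c1 := cliff_mulE 2^-1 2^-1 N1 Ux.
move: c0 c1; move: (cliff_mul _ _ _ _) (cliff_mul _ _ _ _) => z0 z1 c0 c1.
rewrite !mxE !c0 !c1 mulrN mulfV ?pnatr_eq0// rmorphN rmorph1.
by split; ring.
Qed.

(** Since omega is diagonal, the second hypothesis follows from the first in the uses below: the
    spinor derivative preserves S^+ and S^-. *)
Lemma nablaS_coord0 phi x v (k : 'I_2) : (forall q, phi q k 0 = 0) ->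
  (cliff1 *m cliff2 *m phi (sigma x)) k 0 = 0 -> nablaS sigma phi x v k 0 = 0.
Proof.
move=> phi0 vol0.
rewrite /nablaS mxE [X in _ + X]mxE [X in - X]mxE vol0 mulr0 subr0.
rewrite mxE /dir_deriv.
under eq_fun do rewrite phi0; rewrite derive_cst.
by under eq_fun do rewrite phi0; rewrite derive_cst.
Qed.

Lemma nablaS_plus phi x v : spinor_plus phi -> nablaS sigma phi x v 1 0 = 0.
Proof.
move=> [_ phi_plus]; have phi0 q : phi q 1 0 = 0.
  (* In coordinate 1 omega acts as 1, so the eigenvalue -1 forces this coordinate to equal its own
     opposite. *)
  have := congr1 (fun z : 'cV_2 => z 1 0) (phi_plus q).
  rewrite volumeE mxE => /eqP; rewrite -addr_eq0 -mulr2n mulrn_eq0 /=.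
  by move/eqP.
by apply: nablaS_coord0 => //; rewrite volumeE phi0.
Qed.

Lemma nablaS_minus phi x v : spinor_minus phi -> nablaS sigma phi x v 0 0 = 0.
Proof.
move=> [_ phi_minus]; have phi0 q : phi q 0 0 = 0.
  have := congr1 (fun z : 'cV_2 => z 0 0) (phi_minus q).
  rewrite volumeE => /esym/eqP; rewrite -addr_eq0 -mulr2n mulrn_eq0 /=.
  by move/eqP.
by apply: nablaS_coord0 => //; rewrite volumeE phi0 oppr0.
Qed.

End Spinors.

(** * The three conditions on a spinor as equations in the null frame *)

Section Equations.
Variables (R : realType) (M : lorentzian_surface R) (Q : spin_structure M).
Variable phi : Q -> 'cV[R[i]]_2.
Hypothesis fphi : spinor_field phi.

(** The derivative depends on V only through its value at the point, and a vector of the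
    distribution is there a multiple of X. *)
Lemma parallel_along_calX : parallel_along (@in_calX R M) phi <->
  forall U sigma, spin_section U sigma -> forall x, U x ->
    nablaS sigma phi x (X_frame sigma x) = 0.
Proof.
split=> [par U sigma sec x Ux|par W V [_ _ VX] U sigma sec x Wx Ux].
  exact: (par U _ (local_vf_X_frame sec) U sigma sec x Ux Ux).
have [a [b]] := frame_decomposition (frame_oriented sigma x) (V x).
rewrite -/(X_frame sigma x) -/(Y_frame sigma x) => Vx; move: (VX x Wx).
rewrite Vx (in_calX_comb sec)// => -[_ ->].
by rewrite (nablaS_comb sec)// (par U)// rmorph0 scaler0 scale0r addr0.
Qed.

Lemma parallel_along_calY : parallel_along (@in_calY R M) phi <->
  forall U sigma, spin_section U sigma -> forall x, U x ->
    nablaS sigma phi x (Y_frame sigma x) = 0.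
Proof.
split=> [par U sigma sec x Ux|par W V [_ _ VY] U sigma sec x Wx Ux].
  exact: (par U _ (local_vf_Y_frame sec) U sigma sec x Ux Ux).
have [a [b]] := frame_decomposition (frame_oriented sigma x) (V x).
rewrite -/(X_frame sigma x) -/(Y_frame sigma x) => Vx; move: (VY x Wx).
rewrite Vx (in_calY_comb sec)// => -[-> _].
by rewrite (nablaS_comb sec)// (par U)// rmorph0 scaler0 scale0r addr0.
Qed.

Lemma is_harmonicP : is_harmonic phi <->
  forall U sigma, spin_section U sigma -> forall x, U x ->
    nablaS sigma phi x (X_frame sigma x) 0 0 = 0 /\
    nablaS sigma phi x (Y_frame sigma x) 1 0 = 0.
Proof.
have i0 : 'i%C != 0 :> R[i] by rewrite neq0Ci.
have D0 (D NX NY : 'cV[R[i]]_2) :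
    (D 0 0 = 'i%C * NY 1 0) * (D 1 0 = 'i%C * NX 0 0) ->
    D = 0 <-> NX 0 0 = 0 /\ NY 1 0 = 0.
  move=> [E0 E1]; split=> [D0|[N0 N1]]; last first.
    by apply: colP2; rewrite ?E0 ?E1 ?N0 ?N1 mulr0 mxE.
  by split; apply: (mulfI i0); rewrite -?E0 -?E1 D0 mxE mulr0.
split=> H U sigma sec x Ux; apply/(D0 _ _ _ (diracE sec fphi Ux));
  exact: (H U).
Qed.

Lemma is_twistorP : is_twistor phi <->
  forall U sigma, spin_section U sigma -> forall x, U x ->
    nablaS sigma phi x (Y_frame sigma x) 0 0 = 0 /\
    nablaS sigma phi x (X_frame sigma x) 1 0 = 0.
Proof.
have tw U sigma x (a b : R) (sec : spin_section U sigma) (Ux : U x) :=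
  twistor_algebra (nablaS_comb sec a b (X_frame sigma x) (Y_frame sigma x)
    fphi Ux) (cliff_mulE sec a b _ Ux) (diracE sec fphi Ux).
split=> [H U sigma sec x Ux|H W V _ U sigma sec x _ Ux].
  (* The fields Y, with (a, b) = (0, 1), and X, with (a, b) = (1, 0), isolate the two equations. *)
  have oU : open U by case: sec.
  split.
    have := H U _ (And3 oU (smooth_Y_frame sec) (fun _ _ => I)) U _ sec x Ux Ux.
    have := tw U sigma x 0 1 sec Ux; rewrite scale0r scale1r add0r.
    by move=> -> [+ _]; rewrite rmorph1 mul1r.
  have := H U _ (And3 oU (smooth_X_frame sec) (fun _ _ => I)) U _ sec x Ux Ux.
  have := tw U sigma x 1 0 sec Ux; rewrite scale0r scale1r addr0.
  by move=> -> [_ +]; rewrite rmorph1 mul1r.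
have [a [b ->]] := frame_decomposition (frame_oriented sigma x) (V x).
have [NY NX] := H U sigma sec x Ux.
by apply/(tw U) => //; rewrite NX NY !mulr0.
Qed.

End Equations.

Theorem proposition4p1 (R : realType) (M : lorentzian_surface R)
    (Q : spin_structure M) :
  ((forall phi : Q -> 'cV[R[i]]_2, spinor_plus phi ->
      (is_harmonic phi <-> parallel_along (@in_calX R M) phi)) /\
   (forall phi : Q -> 'cV[R[i]]_2, spinor_minus phi ->
      (is_harmonic phi <-> parallel_along (@in_calY R M) phi))) /\
  ((forall phi : Q -> 'cV[R[i]]_2, spinor_plus phi ->
      (is_twistor phi <-> parallel_along (@in_calY R M) phi)) /\
   (forall phi : Q -> 'cV[R[i]]_2, spinor_minus phi ->
      (is_twistor phi <-> parallel_along (@in_calX R M) phi))).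
Proof.
split; split=> phi sphi; have fphi := sphi.1;
  rewrite ?is_harmonicP ?is_twistorP//;
  rewrite ?parallel_along_calX ?parallel_along_calY//;
  split=> H U sigma sec x Ux; have := H U sigma sec x Ux.
(* In each case one of the two scalar equations holds automatically, because the derivative stays in
   S^+ or S^-. The other one concerns the only coordinate that can be nonzero, so it amounts to the
   vanishing of the whole derivative. *)
- by move=> [N _]; apply: colP2; rewrite ?N ?nablaS_plus// mxE.
- by move=> ->; rewrite nablaS_plus// mxE.
- by move=> [_ N]; apply: colP2; rewrite ?N ?nablaS_minus// mxE.
- by move=> ->; rewrite nablaS_minus// mxE.
- by move=> [N _]; apply: colP2; rewrite ?N ?nablaS_plus// mxE.
- by move=> ->; rewrite nablaS_plus// mxE.
- by move=> [_ N]; apply: colP2; rewrite ?N ?nablaS_minus// mxE.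
- by move=> ->; rewrite nablaS_minus// mxE.
Qed.
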